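(* Given any number of measurement settings $m=2^x$ ($m\ge 2$, $x$ an integer), the local bound of the generalized Mermin expression is $$C_{m,n}=\frac{2}{m^n}\sum_{j=0}^{m/2-1}\frac{1}{\sin^{n}\!\left(\frac{(2j+1)\pi}{2m}\right)}$$ for every even number of parties $n\ge n_m^{\mathrm{even}}$, where $$n_m^{\mathrm{even}}=\left\lceil 2\left(1+\frac{\log(\sqrt2)-\log\!\left(m\sin\frac{\pi}{2m}\right)}{\log\!\left(1-4\sin^2\frac{\pi}{2m}\right)}\right)\right\rceil .$$
   Context: There are $n$ parties, each with $m$ measurement settings labelled $0,\dots,m-1$ and outcomes $\pm1$. A deterministic strategy of party $j$ is a vector $\mathbf a^{(j)}=(a^{(j)}_0,\dots,a^{(j)}_{m-1})\in\{\pm1\}^m$. For $\mathbf x=(x_1,\dots,x_n)\in\{0,\dots,m-1\}^n$ put $s(\mathbf x)=\sum_{j=1}^n x_j$ (an ordinary integer sum). The value of the generalized Mermin expression on deterministic strategies is $$\langle\mathcal M_{m,n}\rangle_{\mathbf a^{(1)},\dots,\mathbf a^{(n)}}=\frac{1}{m^{n-1}}\sum_{\substack{\mathbf x\in\{0,\dots,m-1\}^n\\ s(\mathbf x)\equiv0\ (\mathrm{mod}\ m)}}(-1)^{s(\mathbf x)/m}\prod_{j=1}^n a^{(j)}_{x_j}.$$ The local (hidden-variable) bound is $$C_{m,n}=\max_{\mathbf a^{(1)},\dots,\mathbf a^{(n)}\in\{\pm1\}^m}\langle\mathcal M_{m,n}\rangle_{\mathbf a^{(1)},\dots,\mathbf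 a^{(n)}}$$ (allowing shared randomness, i.e. convex mixtures of deterministic strategies, does not change the maximum). *)

(* Defs.v *)
From mathcomp Require Import all_boot all_order all_algebra.
From mathcomp Require Import all_classical all_reals all_analysis.
Set Implicit Arguments.
Unset Strict Implicit.
Unset Printing Implicit Defensive.
Import Order.TTheory GRing.Theory Num.Theory.
Local Open Scope ring_scope.

(* [a j k] encodes the outcome (-1) ^ (a j k) of party [j] for setting [k]. *)
Definition strategies (m n : nat) := {ffun 'I_n -> {ffun 'I_m -> bool}}.

Definition outcome (R : realType) (m n : nat) (a : strategies m n)
    (j : 'I_n) (k : 'I_m) : R := (-1) ^+ a j k.

Definition settings_sum (m n : nat) (x : {ffun 'I_n -> 'I_m}) : nat :=
  (\sum_(j < n) x j)%N.

Definition mermin (R : realType) (m n : nat) (a : strategies m n) : R :=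
  (m%:R ^+ n.-1)^-1 *
  \sum_(x : {ffun 'I_n -> 'I_m} | settings_sum x == 0 %[mod m])
     (-1) ^+ (settings_sum x %/ m) * \prod_(j < n) outcome R a j (x j).

(* The default value of the iterated maximum is itself attained, by the
   strategies whose outcomes are all 1, so this is the maximum of [mermin]. *)
Definition local_bound (R : realType) (m n : nat) : R :=
  \big[Num.max/mermin R [ffun _ : 'I_n => [ffun _ : 'I_m => false]]]_(a : strategies m n)
     mermin R a.

(* For m = 2 the numerator of the quotient is 0 and the argument of the
   logarithm in its denominator is -1; the conventions ln (-1) = 0 and
   0 / 0 = 0 make the quotient 0, hence the threshold 2. *)
Definition n_even (R : realType) (m : nat) : int :=
  let s : R := sin (pi / (2 * m%:R)) in
  Num.ceil (2 * (1 + (ln (Num.sqrt 2) - ln (m%:R * s)) / ln (1 - 4 * s ^+ 2))).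

(* Main.v *)
Require Import Defs.
From mathcomp Require Import all_boot all_order all_algebra.
From mathcomp Require Import all_classical all_reals all_analysis.
From mathcomp Require Import ring lra zify complex.
Set Implicit Arguments.
Unset Strict Implicit.
Unset Printing Implicit Defensive.
Import Order.TTheory GRing.Theory Num.Theory.
Local Open Scope ring_scope.

(* Extend each strategy to an antiperiodic f : nat -> {1, -1}, f (k + m) = - f k,
   and let F(q) = sum_(k < m) f k zeta^(q k) for odd q, where zeta = e^(i pi / m).
   Orthogonality of the odd characters gives mermin = m^-n sum_q prod_j F_j(q), so
   by AM-GM it is enough to maximise sum_q |F(q)|^n over a single f.
   For m a power of 2 every odd q is invertible modulo 2m, so k |-> f (u k) reduces
   every F(q) to an F(1), which is a sum of m of the 2m-th roots of unity, one from
   each antipodal pair. If these fill a half-circle, its modulus is 1 / s with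
   s = sin (pi / 2m); otherwise it is at most (1 - 4 s^2) / s. In the first case,
   for some q, the values |F| are a permutation of those of f = 1 on [0, m), whose
   power sum is the claimed value. If the second case holds for every q, Parseval
   gives sum_q |F(q)|^n <= m^2 ((1 - 4 s^2) / s)^(n - 2), and the threshold on n
   says exactly that this is at most 2 / s^n, the contribution of the two largest
   terms of the claimed value. *)

(** * Sums of a periodic sequence over one period *)

Section PeriodicSums.
Variables (V : zmodType) (N : nat) (h : nat -> V).
Hypothesis hN : forall k, h (k + N)%N = h k.

Lemma periodic_modn k : h (k %% N)%N = h k.
Proof.
rewrite {2}(divn_eq k N); elim: (k %/ N)%N => [|i IH]; first by rewrite mul0n.
by rewrite mulSn [(N + _)%N]addnC addnAC hN.
Qed.

Lemma sum_periodic_shift t : \sum_(k < N) h (t + k)%N = \sum_(k < N) h k.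
Proof.
elim: t => [|t <-]; first by apply: eq_bigr.
case: N hN => [|n] hn; first by rewrite !big_ord0.
rewrite big_ord_recr [RHS]big_ord_recl /= addn0 [RHS]addrC.
by congr (_ + _); [apply: eq_bigr => k _; rewrite /bump /= add1n addnS | rewrite addSnnS hn].
Qed.

(** Multiplication by a unit permutes the residues modulo [N]. *)
Lemma sum_periodic_mul u : coprime u N ->
  \sum_(k < N) h (u * k)%N = \sum_(k < N) h k.
Proof.
move=> cuN; case: (posnP N) => [->|N0]; first by rewrite !big_ord0.
pose s (k : 'I_N) := Ordinal (ltn_pmod (u * k) N0).
rewrite [RHS](reindex_inj (h := s)) /=.
  by apply: eq_bigr => k _; rewrite periodic_modn.
move=> i j [] /eqP e; apply/val_inj => /=.
wlog ij : i j e / (i <= j)%N.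
  by case: (leqP i j) => [/[swap] H /H|/ltnW /[swap] H /H e']; [exact|rewrite e' // eq_sym].
move: e; rewrite eq_sym eqn_mod_dvd ?leq_mul2l ?ij ?orbT // -mulnBr.
rewrite Gauss_dvdr 1?coprime_sym // => d.
have: ((j - i) %% N = 0)%N by apply/eqP.
rewrite modn_small; first by move: ij; lia.
by move: (ltn_ord j); lia.
Qed.

End PeriodicSums.

(** Turns a sum over odd frequencies into one over a full period modulo [2m], to which
    [sum_periodic_mul] applies. *)
Lemma sum_odd_indices (V : zmodType) (m : nat) (h : nat -> V) :
  \sum_(q < m.*2) (if odd q then h q else 0) = \sum_(l < m) h l.*2.+1.
Proof.
elim: m => [|m IH]; first by rewrite !big_ord0.
by rewrite doubleS !big_ord_recr /= IH odd_double addr0.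
Qed.

(** * Unit complex numbers and the squared modulus *)

Section Cis.
Variable R : realType.
Local Open Scope complex_scope.
Local Notation Re := complex.Re.
Local Notation Im := complex.Im.

Definition cis (t : R) : R[i] := cos t +i* sin t.
Definition sqn (z : R[i]) : R := Re z ^+ 2 + Im z ^+ 2.

Lemma cisD s t : cis (s + t) = cis s * cis t.
Proof. by rewrite /cis cosD sinD; apply/eqP; rewrite eq_complex /= eqxx addrC /=. Qed.

Lemma cisX t k : cis t ^+ k = cis (k%:R * t).
Proof.
elim: k => [|k IH]; first by rewrite mul0r /cis cos0 sin0.
by rewrite exprS IH -cisD -natr1 mulrDl mul1r addrC.
Qed.

Lemma sqnM z1 z2 : sqn (z1 * z2) = sqn z1 * sqn z2.
Proof. case: z1 z2 => [a b] [c d]; rewrite /sqn /=; ring. Qed.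

Lemma sqn_ge0 z : 0 <= sqn z.
Proof. by rewrite addr_ge0 ?sqr_ge0. Qed.

Lemma sqn_cis t : sqn (cis t) = 1.
Proof. exact: cos2Dsin2. Qed.

Lemma sqn_conj z : (sqn z)%:C = z * z^*.
Proof.
case: z => a b; apply/eqP.
by rewrite eq_complex /sqn /= -!expr2 mulrN opprK mulrN [b * a]mulrC addNr !eqxx.
Qed.

Lemma Re_sum (I : Type) (r : seq I) (P : pred I) (E : I -> R[i]) :
  Re (\sum_(i <- r | P i) E i) = \sum_(i <- r | P i) Re (E i).
Proof. by apply: (big_morph (@Re R)) => // -[a b] [c d]. Qed.

Lemma Im_sum (I : Type) (r : seq I) (P : pred I) (E : I -> R[i]) :
  Im (\sum_(i <- r | P i) E i) = \sum_(i <- r | P i) Im (E i).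
Proof. by apply: (big_morph (@Im R)) => // -[a b] [c d]. Qed.

End Cis.

(** * Fourier analysis of antiperiodic sequences *)

Section Fourier.
Variables (R : realType) (m : nat).
Hypothesis m0 : (0 < m)%N.
Local Open Scope complex_scope.

Definition antiperiodic (f : nat -> R) := forall k, f (k + m)%N = - f k.

Definition zeta : R[i] := cis (pi / m%:R).

Definition ft (f : nat -> R) (q : nat) : R[i] :=
  \sum_(k < m) (f k)%:C * zeta ^+ (q * k).

(** The sum of [|F(q)|^(2p)] over the odd residues [q = l.*2.+1] modulo [2m]. *)
Definition powsum (p : nat) (f : nat -> R) : R :=
  \sum_(l < m) sqn (ft f l.*2.+1) ^+ p.

Let mR0 : m%:R != 0 :> R. Proof. by rewrite pnatr_eq0 -lt0n. Qed.

Lemma zetaXm : zeta ^+ m = -1.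
Proof.
rewrite /zeta cisX mulrC divfK // /cis cospi sinpi.
by apply/eqP; rewrite eq_complex /= oppr0 !eqxx.
Qed.

Lemma zetaX2m : zeta ^+ (m * 2) = 1.
Proof. by rewrite exprM zetaXm sqrrN expr1n. Qed.

Lemma zetaX_odd_mul q : odd q -> zeta ^+ (q * m) = -1.
Proof. by move=> qo; rewrite mulnC exprM zetaXm -signr_odd qo. Qed.

Lemma sqn_zetaX k : sqn (zeta ^+ k) = 1.
Proof. by rewrite cisX sqn_cis. Qed.

Lemma sqn_real (x : R) : sqn x%:C = x ^+ 2.
Proof. by rewrite /sqn /= expr0n addr0. Qed.

Lemma ft_term_periodic f q : antiperiodic f -> odd q ->
  forall k, (f (k + m)%N)%:C * zeta ^+ (q * (k + m)) = (f k)%:C * zeta ^+ (q * k).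
Proof.
move=> fm qo k; rewrite fm mulnDr exprD zetaX_odd_mul // mulrN1 mulrN.
by rewrite -mulNr; congr (_ * _); apply/eqP; rewrite eq_complex /= opprK oppr0 !eqxx.
Qed.

Lemma sqn_ft_shift f q t : antiperiodic f -> odd q ->
  sqn (ft (fun k => f (t + k)%N) q) = sqn (ft f q).
Proof.
move=> fm qo; rewrite -[LHS]mulr1 -(sqn_zetaX (q * t)) -sqnM; congr sqn.
rewrite /ft -[RHS](sum_periodic_shift (ft_term_periodic fm qo) t) mulr_suml.
by apply: eq_bigr => k _; rewrite -mulrA -exprD -mulnDr addnC.
Qed.

(** For odd [q] the two sign changes cancel, so the summand has period [m] and [k |-> u k] only
    permutes its values. *)
Lemma ft_mul f q u : antiperiodic f -> odd q -> coprime u m ->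
  ft (fun k => f (u * k)%N) (u * q) = ft f q.
Proof.
move=> fm qo cu; rewrite /ft -[RHS](sum_periodic_mul (ft_term_periodic fm qo) cu).
by apply: eq_bigr => k _; rewrite [(q * (_ * _))%N]mulnCA mulnA.
Qed.

Lemma ft_periodic f q : ft f (q + m.*2) = ft f q.
Proof.
rewrite /ft; apply: eq_bigr => k _.
rewrite mulnDl exprD -[m.*2]muln2 -mulnA [_ ^+ (m * _)]exprM zetaXm.
by rewrite [_ ^+ (2 * k)]exprM sqrrN !expr1n mulr1.
Qed.

Lemma powsum_shift p f t : antiperiodic f ->
  powsum p (fun k => f (t + k)%N) = powsum p f.
Proof.
by move=> fm; rewrite /powsum; apply: eq_bigr => l _; rewrite sqn_ft_shift //= odd_double.
Qed.

(** A unit [u] modulo [2m] is odd, so [q |-> u q] permutes the odd residues; then [ft_mul] applies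
    termwise. *)
Lemma powsum_mul p f u : antiperiodic f -> coprime u m.*2 ->
  powsum p (fun k => f (u * k)%N) = powsum p f.
Proof.
move=> fm cu; have [cum cu2] : coprime u m /\ odd u.
  move: cu; rewrite -muln2 coprimeMr coprimen2 => /andP[]; by [].
rewrite /powsum -(sum_odd_indices m (fun q => sqn (ft _ q) ^+ p)).
rewrite -[RHS](sum_odd_indices m (fun q => sqn (ft _ q) ^+ p)).
pose h (q : nat) := if odd q then sqn (ft (fun k => f (u * k)%N) q) ^+ p else 0.
rewrite -[LHS](sum_periodic_mul (h := h) _ cu); last first.
  by move=> k; rewrite /h ft_periodic oddD odd_double addbF.
by apply: eq_bigr => q _; rewrite /h oddM cu2 /=; case: ifP => // qo; rewrite ft_mul.
Qed.

Lemma zeta_neq0 : zeta != 0.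
Proof.
apply/eqP => z0; have := sqn_zetaX 1; rewrite expr1 z0 sqn_real expr0n => /eqP.
by rewrite eq_sym oner_eq0.
Qed.

Lemma zetaX_double_neq1 d : ~~ (m %| d)%N -> zeta ^+ d.*2 != 1.
Proof.
move=> nd; apply/eqP; rewrite {1}(divn_eq d m) -muln2 mulnDl -mulnA exprD.
rewrite [(_ %/ m * _)%N]mulnC exprM zetaX2m expr1n mul1r exprM => /eqP; rewrite sqrf_eq1.
have r0 : (0 < d %% m)%N by rewrite lt0n.
have rm : (d %% m < m)%N by rewrite ltn_mod.
(* [zeta ^+ d.*2 = 1] would force [zeta ^+ (d %% m)] to be 1 or -1, hence to have zero imaginary
   part. *)
have : 0 < sin ((d %% m)%:R * (pi / m%:R)) :> R.
  apply: sin_gt0_pi; rewrite mulr_gt0 ?divr_gt0 ?pi_gt0 ?ltr0n //=.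
  by rewrite mulrCA gtr_pMr ?pi_gt0 // ltr_pdivrMr ?ltr0n // mul1r ltr_nat.
rewrite /zeta cisX !eq_complex /= oppr0 -andb_orl => /[swap] /andP[_ /eqP ->].
by rewrite ltxx.
Qed.

(** A geometric sum of ratio [zeta ^+ d.*2], which is 1 only if [m] divides [d]. This produces both
    the congruence condition and the sign in [mermin]. *)
Lemma zeta_orthogonality d :
  \sum_(l < m) zeta ^+ (l.*2.+1 * d) =
  if (m %| d)%N then m%:R * (-1) ^+ (d %/ m) else 0.
Proof.
have -> : \sum_(l < m) zeta ^+ (l.*2.+1 * d) =
    zeta ^+ d * \sum_(l < m) (zeta ^+ d.*2) ^+ l.
  by rewrite mulr_sumr; apply: eq_bigr => l _; rewrite -exprM -exprD; congr (_ ^+ _); lia.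
case: ifPn => [/dvdnP[k ->]|nd].
  have zk : zeta ^+ (k * m) = (-1) ^+ k by rewrite mulnC exprM zetaXm.
  rewrite mulnK // zk mulrC; congr (_ * _).
  rewrite (eq_bigr (fun=> 1)) ?sumr_const ?card_ord // => l _.
  by rewrite -muln2 exprM zk sqrr_sign expr1n.
apply/eqP; rewrite mulf_eq0 expf_eq0 (negPf zeta_neq0) andbF /=.
have := subrX1 (zeta ^+ d.*2) m.
have -> : zeta ^+ d.*2 ^+ m = 1.
  by rewrite -exprM -muln2 -mulnA [(2 * m)%N]mulnC mulnC exprM zetaX2m expr1n.
by move/esym/eqP; rewrite subrr mulf_eq0 subr_eq0 (negPf (zetaX_double_neq1 nd)).
Qed.

(** The conjugate is the inverse; [zeta ^+ (q * m) = -1] lets it be written with a natural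
    exponent. *)
Lemma conj_zetaX q k : odd q -> (k <= m)%N ->
  (zeta ^+ (q * k))^* = - zeta ^+ (q * (m - k)).
Proof.
move=> qo km; have z0 : zeta ^+ (q * k) != 0 by rewrite expf_neq0 ?zeta_neq0.
apply: (mulfI z0); rewrite -sqn_conj sqn_zetaX mulrN -exprD -mulnDr subnKC //.
by rewrite zetaX_odd_mul // opprK.
Qed.

Lemma sqn_ft f q : odd q ->
  (sqn (ft f q))%:C =
  \sum_(j < m) \sum_(k < m) (f j * f k)%:C * - zeta ^+ (q * (j + (m - k))).
Proof.
move=> qo; rewrite sqn_conj /ft raddf_sum /= big_distrl /=.
apply: eq_bigr => j _; rewrite big_distrr /=; apply: eq_bigr => k _.
rewrite [X in _ * X = _]rmorphM [X in _ * (X * _)]conjc_real.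
rewrite [X in _ * (_ * X)](conj_zetaX qo (ltnW (ltn_ord k))) mulrACA -rmorphM.
by rewrite mulrN -exprD -mulnDr.
Qed.

Lemma parseval f : \sum_(l < m) sqn (ft f l.*2.+1) = m%:R * \sum_(k < m) f k ^+ 2.
Proof.
apply: (@complexI R); rewrite rmorph_sum rmorphM rmorph_nat rmorph_sum /= mulr_sumr.
under eq_bigr => l _ do rewrite sqn_ft /= ?odd_double //.
rewrite exchange_big; apply: eq_bigr => j _ /=.
have e k : \sum_(l < m) (f j * f k)%:C * - zeta ^+ (l.*2.+1 * (j + (m - k))) =
    (f j * f k)%:C * - (if (m %| j + (m - k))%N
       then m%:R * (-1) ^+ ((j + (m - k)) %/ m) else 0).
  by rewrite -zeta_orthogonality -sumrN big_distrr.
rewrite exchange_big /=; under eq_bigr => k _ do rewrite e.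
rewrite (bigD1 j) //= big1 ?addr0 => [|k kj].
  by rewrite subnKC ?[(j <= m)%N]ltnW // dvdnn divnn m0 mulrN1 opprK mulrC.
rewrite ifF ?oppr0 ?mulr0 //; apply/negP => /dvdnP[c hc].
move/eqP: kj; apply; apply/val_inj => /=; move: (ltn_ord j) (ltn_ord k) => jm km.
(* [j + (m - k)] lies strictly between 0 and [2m], so the only multiple of [m] it can be is [m]
   itself, which forces [k = j]. *)
have c1 : c = 1%N by nia.
by move: hc; rewrite c1; lia.
Qed.

(** Expanding the product gives one term [zeta ^+ (q * settings_sum x)] per choice of settings;
    orthogonality in [q] selects the admissible [x]. *)
Lemma sum_prod_ft (n : nat) (f : 'I_n -> nat -> R) :
  \sum_(l < m) \prod_(j < n) ft (f j) l.*2.+1 =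
  (m%:R * \sum_(x : {ffun 'I_n -> 'I_m} | settings_sum x == 0 %[mod m])
    (-1) ^+ (settings_sum x %/ m) * \prod_(j < n) f j (x j))%:C.
Proof.
rewrite rmorphM rmorph_nat raddf_sum /= mulr_sumr.
under eq_bigr => l _ do rewrite bigA_distr_bigA.
rewrite exchange_big [RHS]big_mkcond; apply: eq_bigr => x _ /=.
under eq_bigr => l _.
  rewrite big_split /= prodrXr -big_distrr /=. over.
rewrite -mulr_sumr zeta_orthogonality mod0n /dvdn -/(settings_sum x).
case: ifP; last by rewrite mulr0.
by rewrite rmorphM rmorphXn rmorphN1 rmorph_prod /= [LHS]mulrC mulrA.
Qed.

End Fourier.

(** * The bound on [|F(1)|] away from half-circles *)

Lemma sin_ge_pi (R : realType) (a x : R) : 0 <= a -> a <= x <= pi - a -> sin a <= sin x.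
Proof.
move=> a0 /andP[ax xa]; have pi0 := pi_gt0 R.
have a2 : a <= pi / 2 by lra.
wlog x2 : x ax xa / x <= pi / 2 => [H|].
  case: (leP x (pi / 2)) => [|x2]; first exact: H.
  have -> : sin x = sin (pi - x) by rewrite sinB sinpi cospi; ring.
  by apply: H; lra.
move: ax; rewrite le_eqVlt => /predU1P[->//|ax].
by apply: ltW; rewrite ltr_sin // in_itv /=; apply/andP; split; lra.
Qed.

(* For [0 < a < pi], [0 <= v] and [v + a <= pi], the vector at angle [u + v] is thus a
   nonnegative combination of those at angles [u] and [u - a + pi]. *)
Lemma sin_mul_halfcircle (R : realType) (x y u v a : R) :
  sin a * (x * cos (u + v) + y * sin (u + v)) =
  sin (v + a) * (x * cos u + y * sin u) + sin v * - (x * cos (u - a) + y * sin (u - a)).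
Proof. rewrite !(cosB, sinB, cosD, sinD); ring. Qed.

Section SecondLargest.
Variables (R : realType) (m : nat) (f : nat -> R).
Hypothesis m_gt1 : (1 < m)%N.
Hypothesis fm : antiperiodic m f.
Hypothesis f1 : forall k, f k = 1 \/ f k = -1.

Local Notation alpha := (@pi R / m%:R).
Local Notation theta := (@pi R / (2 * m%:R)).
Local Notation s := (sin theta).
Local Notation x := (\sum_(k < m) f k * cos (k%:R * alpha)).
Local Notation y := (\sum_(k < m) f k * sin (k%:R * alpha)).

(* With [z = x + i y], which is [ft m f 1], [h k] is the inner product of [z] with
   [zeta ^+ k], and [H t] that of [z] with the sum of a half-circle. *)
Let h (k : nat) : R := x * cos (k%:R * alpha) + y * sin (k%:R * alpha).
Let H (t : nat) : R := \sum_(k < m) h (t + k).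

Let mR0 : m%:R != 0 :> R. Proof. by rewrite pnatr_eq0; lia. Qed.
Let mR2 : 2 <= m%:R :> R. Proof. by rewrite (ler_nat R 2). Qed.

Lemma theta_gt0 : 0 < theta :> R.
Proof. by rewrite divr_gt0 ?pi_gt0 //; have := mR2; lra. Qed.

Lemma theta_mul : m%:R * theta = pi / 2 :> R.
Proof. by field. Qed.

Lemma sin_theta_gt0 : 0 < s :> R.
Proof.
have := theta_gt0; have := theta_mul; have := pi_gt0 R; move: mR2.
by move=> *; apply: sin_gt0_pi; apply/andP; split; nra.
Qed.

Lemma angleD k : (k + m)%:R * alpha = k%:R * alpha + pi :> R.
Proof. by rewrite natrD mulrDl [m%:R * _]mulrC divfK. Qed.

Let hm : antiperiodic m h.
Proof. by move=> k; rewrite /h angleD cosDpi sinDpi; ring. Qed.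

(** The window loses [h t] and gains [h (t + m) = - h t]. *)
Let HS t : H t.+1 = H t - 2 * h t.
Proof.
rewrite /H; have [n mn] : exists n, m = n.+1 by exists m.-1; lia.
move: hm; rewrite mn => hn; rewrite big_ord_recr [in RHS]big_ord_recl /= addn0.
rewrite addSnnS hn (eq_bigr (fun k : 'I_n => h (t + bump 0 k)%N)); first by ring.
by move=> k _; rewrite /bump /= add1n addSnnS.
Qed.

Let H2m t : H (t + m.*2) = H t.
Proof.
rewrite /H; apply: eq_bigr => k _.
by rewrite -addnn addnA addnAC hm addnAC hm opprK.
Qed.

Let energy t : x ^+ 2 + y ^+ 2 = \sum_(k < m) f (t + k)%N * h (t + k)%N.
Proof.
rewrite (sum_periodic_shift (h := fun k => f k * h k)); last first.
  by move=> k; rewrite fm hm mulrNN.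
rewrite !expr2 [in X in X + _]mulr_sumr [in X in _ + X]mulr_sumr -big_split.
by apply: eq_bigr => k _ /=; rewrite /h; ring.
Qed.

(** Compares [f] with the half-circle starting at [t]: only indices with [f = -1] contribute to the
    defect. *)
Let energyH t : x ^+ 2 + y ^+ 2 = H t - \sum_(k < m) (1 - f (t + k)%N) * h (t + k)%N.
Proof. by rewrite (energy t) /H -sumrB; apply: eq_bigr => k _; ring. Qed.

(* For [t] maximising [H], the comparison with [H t.+1] and with [H (t - 1)] gives the
   two signs [0 <= h t] and [0 <= h (t + m.-1)] at the ends of the half-circle. *)
Lemma exists_best_halfcircle : exists t, forall j, (j < m)%N -> 0 <= h (t + j)%N.
Proof.
have m20 : (0 < m.*2)%N by lia.
case: (@arg_maxP _ _ _ (Ordinal m20) predT (fun t : 'I_(m.*2) => H t) isT) => t _ tmax.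
have Hmax t' : H t' <= H t.
  rewrite -(periodic_modn H2m); exact: (tmax (Ordinal (ltn_pmod t' m20))).
have h0 : 0 <= h t by have := Hmax t.+1; rewrite HS; lra.
have h1 : 0 <= h (t + m.-1)%N.
  (* Modulo [2m], [t + m.-1 + m] stands for [t - 1]. *)
  have := HS (t + m.-1 + m)%N; have -> : (t + m.-1 + m).+1 = (t + m.*2)%N by lia.
  by rewrite H2m hm; have := Hmax (t + m.-1 + m)%N; lra.
exists t => j jm.
have am : m%:R * alpha = pi :> R by field.
have a0 : 0 < alpha :> R by rewrite divr_gt0 ?pi_gt0 //; have := mR2; lra.
have sa : 0 < sin alpha :> R.
  by apply: sin_gt0_pi; rewrite a0 /= -[X in _ < X]am; have := mR2; nra.
have e : sin alpha * h (t + j)%N =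
    sin (j.+1%:R * alpha) * h t + sin (j%:R * alpha) * h (t + m.-1)%N.
  have -> : h (t + m.-1)%N =
      - (x * cos (t%:R * alpha - alpha) + y * sin (t%:R * alpha - alpha)).
    have -> : t%:R * alpha - alpha = (t + m.-1)%:R * alpha - pi :> R.
      by rewrite natrD -subn1 natrB ?(ltnW m_gt1) //; field.
    by rewrite /h cosB sinB cospi sinpi; ring.
  have -> : j.+1%:R * alpha = j%:R * alpha + alpha :> R by rewrite -natr1 mulrDl mul1r.
  by rewrite /h natrD [(_ + _) * alpha]mulrDl sin_mul_halfcircle.
rewrite -(pmulr_rge0 _ sa) e addr_ge0 // mulr_ge0 //; apply: sin_ge0_pi.
  by rewrite mulr_ge0 ?ler0n ?(ltW a0) //= -[X in _ <= X]am ler_pM2r // ler_nat.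
by rewrite mulr_ge0 ?ler0n ?(ltW a0) //= -[X in _ <= X]am ler_pM2r // ler_nat ltnW.
Qed.

Let angle t k : (t + k)%:R * alpha = (2 * t%:R - 1) * theta + (2 * k%:R + 1) * theta :> R.
Proof. by rewrite natrD; field. Qed.

(** Multiplied by [2 * s], each cosine becomes a difference of sines at angles half a step away, and
    the sum telescopes. *)
Let sum_cos t :
  \sum_(k < m) cos ((t + k)%:R * alpha) = - sin ((2 * t%:R - 1) * theta) / s :> R.
Proof.
have s0 : s != 0 :> R := lt0r_neq0 sin_theta_gt0.
apply: (mulfI (x := 2 * s)); first by rewrite mulf_neq0 // pnatr_eq0.
rewrite mulr_sumr.
pose g k := sin ((2 * (t + k)%:R - 1) * theta).
rewrite (eq_bigr (fun k : 'I_m => g k.+1 - g k)); last first.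
  move=> k _; rewrite /g.
  have -> : (2 * (t + k.+1)%:R - 1) * theta = (t + k)%:R * alpha + theta :> R.
    by rewrite addnS -natr1; field.
  have -> : (2 * (t + k)%:R - 1) * theta = (t + k)%:R * alpha - theta :> R by field.
  by rewrite sinD sinB; ring.
rewrite -(big_mkord xpredT (fun k => g k.+1 - g k)) telescope_sumr // /g addn0.
have -> : (2 * (t + m)%:R - 1) * theta = (2 * t%:R - 1) * theta + pi :> R.
  by rewrite natrD; field.
by rewrite sinDpi; field.
Qed.

Let sum_sin t :
  \sum_(k < m) sin ((t + k)%:R * alpha) = cos ((2 * t%:R - 1) * theta) / s :> R.
Proof.
have s0 : s != 0 :> R := lt0r_neq0 sin_theta_gt0.
apply: (mulfI (x := - 2 * s)); first by rewrite mulf_neq0 // oppr_eq0 pnatr_eq0.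
rewrite mulr_sumr.
pose g k := cos ((2 * (t + k)%:R - 1) * theta).
rewrite (eq_bigr (fun k : 'I_m => g k.+1 - g k)); last first.
  move=> k _; rewrite /g.
  have -> : (2 * (t + k.+1)%:R - 1) * theta = (t + k)%:R * alpha + theta :> R.
    by rewrite addnS -natr1; field.
  have -> : (2 * (t + k)%:R - 1) * theta = (t + k)%:R * alpha - theta :> R by field.
  by rewrite cosD cosB; ring.
rewrite -(big_mkord xpredT (fun k => g k.+1 - g k)) telescope_sumr // /g addn0.
have -> : (2 * (t + m)%:R - 1) * theta = (2 * t%:R - 1) * theta + pi :> R.
  by rewrite natrD; field.
by rewrite cosDpi; field.
Qed.

Let HE t :
  H t = x * (- sin ((2 * t%:R - 1) * theta) / s) + y * (cos ((2 * t%:R - 1) * theta) / s).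
Proof. by rewrite -sum_cos -sum_sin !mulr_sumr -big_split. Qed.

Lemma second_largest_modulus : ~ (exists t, forall k, (k < m)%N -> f (t + k)%N = 1) ->
  4 * s ^+ 2 <= 1 -> x ^+ 2 + y ^+ 2 <= ((1 - 4 * s ^+ 2) / s) ^+ 2.
Proof.
move=> nf s4; have sp := sin_theta_gt0; have s0 := lt0r_neq0 sp.
(* If [|z|^2 <= <z, w>] then [|z| <= |w|]. Here [w] will be the half-circle sum with one or two of
   its vectors reversed. *)
have cauchy (a b : R) : a ^+ 2 + b ^+ 2 <= ((1 - 4 * s ^+ 2) / s) ^+ 2 ->
    x ^+ 2 + y ^+ 2 <= x * a + y * b -> x ^+ 2 + y ^+ 2 <= ((1 - 4 * s ^+ 2) / s) ^+ 2.
  move: x y ((1 - 4 * s ^+ 2) / s) => u v w ab uv; apply: le_trans ab.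
  by have := sqr_ge0 (u - a); have := sqr_ge0 (v - b); nra.
have [t ht] := exists_best_halfcircle.
have terms k : (k < m)%N -> 0 <= (1 - f (t + k)%N) * h (t + k)%N.
  by move=> km; rewrite mulr_ge0 ?ht //; case: (f1 (t + k)%N) => ->; lra.
(* First case: a sign is flipped strictly inside the best half-circle. All other defect terms are
   nonnegative and dropped. *)
case: (pselect (exists j, [/\ (0 < j)%N, (j.+1 < m)%N & f (t + j)%N = -1])).
  case=> j [j0 jm fj]; have jm' : (j < m)%N by lia.
  set b := (2 * t%:R - 1) * theta; set g := (2 * j%:R + 1) * theta.
  apply: (cauchy (- sin b / s - 2 * cos (b + g)) (cos b / s - 2 * sin (b + g))).
    (* The left side is [sin (3 * theta)], and an interior [j] keeps [g] between [3 * theta] and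
       [pi - 3 * theta]. *)
    have s3 : 3 * s - 4 * s ^+ 3 <= sin g.
      have -> : 3 * s - 4 * s ^+ 3 = sin (3 * theta) :> R.
        have -> : 3 * theta = theta + theta + theta :> R by ring.
        rewrite !(sinD, cosD); have := cos2sin2 theta; move: (cos theta) s => c d cd.
        have -> : (d * c + c * d) * c + (c * c - d * d) * d = 3 * d * c ^+ 2 - d ^+ 3 by ring.
        by rewrite cd; ring.
      have t0 := theta_gt0; apply: sin_ge_pi; first by lra.
      rewrite /g; have -> : pi - 3 * theta = (2 * m%:R - 3) * theta by field.
      rewrite !ler_pM2r //.
      have : 1 <= j%:R :> R by rewrite (ler_nat R 1).
      have : j%:R + 1 + 1 <= m%:R :> R by rewrite !natr1 ler_nat.
      by lra.
    have -> : (- sin b / s - 2 * cos (b + g)) ^+ 2 + (cos b / s - 2 * sin (b + g)) ^+ 2 =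
        (s ^+ 2)^-1 + 4 - 4 * sin g / s.
      rewrite cosD sinD; have := cos2Dsin2 b; have := cos2Dsin2 g.
      move: (cos b) (sin b) (cos g) (sin g) => cb sb cg sg e1 e2.
      transitivity ((cb ^+ 2 + sb ^+ 2) *
        ((s ^+ 2)^-1 + 4 * (cg ^+ 2 + sg ^+ 2) - 4 * sg / s)).
        by field.
      by rewrite e1 e2; field.
    have -> : ((1 - 4 * s ^+ 2) / s) ^+ 2 =
        (s ^+ 2)^-1 + 4 - 4 * (3 * s - 4 * s ^+ 3) / s by field.
    by rewrite lerB // ler_pM2r ?invr_gt0 // ler_pM2l.
  rewrite (energyH t) (bigD1 (Ordinal jm')) //= fj HE -/b.
  have : 0 <= \sum_(k < m | k != Ordinal jm') (1 - f (t + k)%N) * h (t + k)%N.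
    by apply: sumr_ge0 => k _; apply: terms.
  have -> : h (t + j)%N = x * cos (b + g) + y * sin (b + g) by rewrite /h angle.
  move: (\sum_(k < m | _ != _) _) x y => S u v S0.
  rewrite -subr_ge0; apply: (le_trans S0); rewrite le_eqVlt; apply/orP; left.
  by apply/eqP; ring.
move=> nj.
have inner j : (0 < j)%N -> (j.+1 < m)%N -> f (t + j)%N = 1.
  by move=> j0 jm; case: (f1 (t + j)%N) => // fj; case: nj; exists j.
have m1m : (m.-1 < m)%N by lia.
have m00 : (0 < m)%N by lia.
(* Only the two ends can be flipped. Flipping none or just one leaves a half-circle, starting at
   [t], [t - 1] or [t + 1], which [nf] excludes. *)
case: (f1 t) => f0; case: (f1 (t + m.-1)%N) => fl.
- case: nf; exists t => k km; case: (posnP k) => [->|k0]; first by rewrite addn0.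
  have [->|km'] := eqVneq k m.-1; first by [].
  by apply: inner; lia.
- case: nf; exists (t + m.-1 + m)%N => k km.
  have -> : (t + m.-1 + m + k = t + m.-1 + k + m)%N by lia.
  rewrite fm; case: (posnP k) => [->|k0]; first by rewrite addn0 fl opprK.
  have -> : (t + m.-1 + k = t + k.-1 + m)%N by lia.
  rewrite fm opprK; case: (posnP k.-1) => [->|k1]; first by rewrite addn0.
  by apply: inner; lia.
- case: nf; exists t.+1 => k km; rewrite addSnnS.
  have [->|km'] := eqVneq k.+1 m; first by rewrite fm f0 opprK.
  have [->|km2] := eqVneq k.+1 m.-1; first by [].
  by apply: inner; lia.
set b := (2 * t%:R - 1) * theta.
(* Both ends flipped: the end vectors add up to length [2 * s] along the half-circle sum, of length
   [1 / s], which leaves [1 / s - 4 * s]. *)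
apply: (cauchy (- sin b / s * (1 - 4 * s ^+ 2)) (cos b / s * (1 - 4 * s ^+ 2))).
  rewrite !exprMn sqrrN -mulrDl -mulrDl [sin b ^+ 2 + _]addrC cos2Dsin2 mul1r mulrC.
  by rewrite le_eqVlt eqxx.
have lst : Ordinal m1m != Ordinal m00 by apply/eqP => -[]; lia.
rewrite (energyH t) (bigD1 (Ordinal m00)) //= (bigD1 (Ordinal m1m)) //= addn0 f0 fl HE -/b.
have : 0 <= \sum_(k < m | (k != Ordinal m00) && (k != Ordinal m1m))
    (1 - f (t + k)%N) * h (t + k)%N.
  by apply: sumr_ge0 => k _; apply: terms.
have -> : h t = x * cos (b + theta) + y * sin (b + theta).
  by rewrite -[in LHS](addn0 t) /h angle mulr0 add0r mul1r.
have -> : h (t + m.-1)%N = x * - cos (b - theta) + y * - sin (b - theta).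
  rewrite /h angle -/b.
  have -> : b + (2 * m.-1%:R + 1) * theta = b - theta + pi.
    by rewrite -subn1 natrB ?(ltnW m_gt1) //; field.
  by rewrite cosDpi sinDpi.
move: (\sum_(k < m | _ && _) _) x y => S u v S0.
rewrite -subr_ge0; apply: (le_trans S0); rewrite le_eqVlt; apply/orP; left; apply/eqP.
by rewrite !(cosB, sinB) !(cosD, sinD); field.
Qed.

End SecondLargest.

(** * The transform of a half-circle *)

Section HalfCircle.
Variables (R : realType) (m : nat).
Hypothesis m0 : (0 < m)%N.
Local Open Scope complex_scope.
Local Notation theta := (@pi R / (2 * m%:R)).

(** The power sum of a half-circle, for which [|F(q)| = 1 / |sin (q * theta)|]; here [q] runs over
    all odd residues modulo [2m]. *)
Definition mermin_value (p : nat) : R :=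
  \sum_(l < m) ((sin (l.*2.+1%:R * theta) ^+ 2)^-1) ^+ p.

Let mR0 : m%:R != 0 :> R. Proof. by rewrite pnatr_eq0 -lt0n. Qed.

Lemma cos_double_angle q : cos (q%:R * (pi / m%:R)) = 1 - 2 * sin (q%:R * theta) ^+ 2.
Proof.
have -> : q%:R * (pi / m%:R) = q%:R * theta *+ 2 by rewrite -mulr_natr; field.
by rewrite cos_mulr2n cos2sin2 -mulr_natr; ring.
Qed.

(** The square of [1 - e^(it) = -2i sin (t/2) e^(it/2)]. *)
Lemma sqr_sub1_zetaX q :
  (1 - zeta R m ^+ q) ^+ 2 = - 4 * zeta R m ^+ q * (sin (q%:R * theta) ^+ 2)%:C.
Proof.
rewrite /zeta cisX /cis; set t := q%:R * (pi / m%:R).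
have e1 : sin (q%:R * theta) ^+ 2 = (1 - cos t) / 2 by rewrite cos_double_angle; field.
rewrite e1; have := cos2Dsin2 t; move: (cos t) (sin t) => c d cd.
have -> : (-4 : R[i]) = (-4 : R)%:C by rewrite rmorphN rmorph_nat.
have d2 : d * d = 1 - c * c by rewrite -!expr2 -cd; ring.
apply/eqP; rewrite expr2 eq_complex /=; apply/andP; split; apply/eqP; last by field.
by rewrite !(mulr0, mul0r, addr0, subr0, oppr0, add0r, sub0r) mulrNN d2; field.
Qed.

Lemma ft_ones (g : nat -> R) q : (forall k, (k < m)%N -> g k = 1) -> odd q ->
  ft m g q * (1 - zeta R m ^+ q) = 2.
Proof.
move=> g1 qo; have -> : ft m g q = \sum_(k < m) (zeta R m ^+ q) ^+ k.
  by rewrite /ft; apply: eq_bigr => k _; rewrite g1 // mul1r exprM.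
have := subrX1 (zeta R m ^+ q) m; rewrite -exprM (zetaX_odd_mul _ m0) // => e.
by rewrite -[1 - _]opprB mulrN mulrC -e -opprD opprK.
Qed.

Lemma zetaX_neq0 q : zeta R m ^+ q != 0.
Proof. by rewrite expf_neq0 // zeta_neq0. Qed.

(** [F = 2 / (1 - zeta ^+ q)] has real part 1, so [2 - F] is its conjugate and the product is
    [|F|^2]. *)
Lemma ft_ones_reflection (g : nat -> R) q : (forall k, (k < m)%N -> g k = 1) -> odd q ->
  ft m g q * (2 - ft m g q) = ((sin (q%:R * theta) ^+ 2)^-1)%:C.
Proof.
move=> g1 qo; have e := ft_ones g1 qo; have e2 := sqr_sub1_zetaX q.
set F := ft m g q in e *; set z := zeta R m ^+ q in e e2.
have n4 : (-4 : R[i]) * z != 0 by rewrite mulf_neq0 ?zetaX_neq0 // oppr_eq0 pnatr_eq0.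
have e3 : F * (2 - F) * (sin (q%:R * theta) ^+ 2)%:C = 1.
  apply: (mulfI n4); rewrite mulrCA -e2 mulr1.
  transitivity ((F * (1 - z)) * (2 * (1 - z) - F * (1 - z))); first by ring.
  by rewrite e; ring.
have n0 : (sin (q%:R * theta) ^+ 2)%:C != 0 :> R[i].
  by apply/eqP => e0; move/eqP: e3; rewrite e0 mulr0 eq_sym oner_eq0.
by apply: (mulIf n0); rewrite e3 -rmorphM mulVf // -(inj_eq (@complexI R)).
Qed.

Lemma sqn_ft_ones (g : nat -> R) q : (forall k, (k < m)%N -> g k = 1) -> odd q ->
  sqn (ft m g q) = (sin (q%:R * theta) ^+ 2)^-1.
Proof.
move=> g1 qo; have := congr1 (@sqn R) (ft_ones g1 qo); rewrite sqnM.
have -> : sqn (2 : R[i]) = 4.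
  by have -> : (2 : R[i]) = (2 : R)%:C by [rewrite rmorph_nat]; rewrite sqn_real -natrX.
have -> : sqn (1 - zeta R m ^+ q) = 4 * sin (q%:R * theta) ^+ 2.
  rewrite /zeta cisX; set t := q%:R * (pi / m%:R).
  have -> : 4 * sin (q%:R * theta) ^+ 2 = 2 * (1 - cos t).
    by rewrite cos_double_angle; ring.
  by rewrite /sqn /= sub0r sqrrN sin2cos2; ring.
move=> e; have n0 : sin (q%:R * theta) ^+ 2 != 0.
  by apply/eqP => e0; move/eqP: e; rewrite e0 !mulr0 eq_sym pnatr_eq0.
apply: (mulIf n0); rewrite mulVf //.
by apply: (@mulfI _ 4); rewrite ?pnatr_eq0 // mulr1 -[RHS]e mulrCA.
Qed.

Lemma powsum_consecutive p (f : nat -> R) :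
  antiperiodic m f -> (exists t, forall k, (k < m)%N -> f (t + k)%N = 1) ->
  powsum m p f = mermin_value p.
Proof.
move=> fm [t ft1]; rewrite -(powsum_shift m0 p t fm) /powsum /mermin_value.
by apply: eq_bigr => l _; rewrite (sqn_ft_ones ft1) //= odd_double.
Qed.

(** Keeps the terms [q = 1] and [q = 2m - 1], whose sines agree. *)
Lemma mermin_value_ge p : (1 < m)%N -> 2 * ((sin theta ^+ 2)^-1) ^+ p <= mermin_value p.
Proof.
move=> m1; have m1m : (m.-1 < m)%N by lia.
rewrite /mermin_value (bigD1 (Ordinal m0)) //= (bigD1 (Ordinal m1m)) /=; last first.
  by apply/eqP => -[]; lia.
have -> : m.-1.*2.+1%:R * theta = pi - theta.
  have -> : m.-1.*2.+1%:R = 2 * m%:R - 1 :> R.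
    by rewrite -natrM -[1]/(1%:R) -natrB; [congr _%:R|]; lia.
  by field.
have -> : sin (pi - theta) = sin theta by rewrite sinB sinpi cospi; ring.
rewrite mul1r addrA -mulr2n mulr_natl lerDl sumr_ge0 // => l _.
by rewrite exprn_ge0 // invr_ge0 sqr_ge0.
Qed.

Lemma sqn_ft1 (f : nat -> R) : sqn (ft m f 1) =
  (\sum_(k < m) f k * cos (k%:R * (pi / m%:R))) ^+ 2 +
  (\sum_(k < m) f k * sin (k%:R * (pi / m%:R))) ^+ 2.
Proof.
rewrite /sqn /ft Re_sum Im_sum; congr (_ ^+ 2 + _ ^+ 2); apply: eq_bigr => k _;
by rewrite mul1n /zeta cisX /= !mul0r ?subr0 ?addr0.
Qed.

End HalfCircle.

(** * Maximality of the half-circle power sum *)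

Section PowsumBound.
Variables (R : realType) (m x : nat).
Hypothesis m_pow2 : m = (2 ^ x)%N.
Hypothesis m_gt1 : (1 < m)%N.
Let m0 : (0 < m)%N. Proof. exact: ltnW. Qed.
Local Notation s := (sin (@pi R / (2 * m%:R))).

Lemma coprime_odd_double q : odd q -> coprime q m.*2.
Proof. by move=> qo; rewrite m_pow2 -mul2n -expnS coprimeXr // coprimen2. Qed.

Lemma inverse_mod_double q : odd q ->
  exists2 u, coprime u m.*2 & ((u * q) %% m.*2 = 1)%N.
Proof.
move=> qo; have cq := coprime_odd_double qo.
(* The Chinese remainder is a multiple of [q] congruent to 1 modulo [2m]; its quotient by [q] is the
   inverse. *)
exists (chinese q m.*2 0 1 %/ q)%N.
  have := chinese_modr cq 0 1; have := chinese_modl cq 0 1; rewrite mod0n.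
  move=> /eqP; rewrite -/(dvdn _ _) => /divnK e; rewrite -{1}e => e1.
  have : coprime (chinese q m.*2 0 1 %/ q * q) m.*2.
    by rewrite -coprime_modl e1 coprime_modl coprime1n.
  by rewrite coprimeMl => /andP[].
have := chinese_modr cq 0 1; have := chinese_modl cq 0 1; rewrite mod0n.
move=> /eqP; rewrite -/(dvdn _ _) => /divnK -> ->; rewrite modn_small //; lia.
Qed.

Lemma antiperiodic_mul (f : nat -> R) u :
  antiperiodic m f -> odd u -> antiperiodic m (fun k => f (u * k)%N).
Proof.
move=> fm uo k; rewrite mulnDr.
have fX i j : f (i + j * m)%N = (-1) ^+ j * f i.
  elim: j => [|j IH]; first by rewrite addn0 mul1r.
  by rewrite mulSn addnCA addnC fm IH exprS mulN1r mulNr.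
by rewrite fX -signr_odd uo expr1 mulN1r.
Qed.

Lemma powsum_le p (f : nat -> R) :
  antiperiodic m f -> (forall k, f k = 1 \/ f k = -1) ->
  4 * s ^+ 2 <= 1 -> (1 - 4 * s ^+ 2) ^+ p.*2 <= 2 / (m%:R * s) ^+ 2 ->
  powsum m p.+1 f <= mermin_value R m p.+1.
Proof.
move=> fm f1 s4 hp; have sp : 0 < s := sin_theta_gt0 R m_gt1.
case: (pselect (exists2 u, coprime u m.*2 &
    exists t, forall k, (k < m)%N -> f (u * (t + k))%N = 1)).
  case=> u cu ex; rewrite -(powsum_mul m0 _ fm cu) (powsum_consecutive m0) //.
  apply: antiperiodic_mul => //.
  by move: cu; rewrite -muln2 coprimeMr coprimen2 => /andP[].
move=> nex; pose mu2 := ((1 - 4 * s ^+ 2) / s) ^+ 2.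
have mu0 : 0 <= mu2 by exact: sqr_ge0.
have small l : sqn (ft m f l.*2.+1) <= mu2.
  have qo : odd l.*2.+1 by rewrite /= odd_double.
  have [u cu uq] := inverse_mod_double qo.
  have [cum uo] : coprime u m /\ odd u.
    by move: cu; rewrite -muln2 coprimeMr coprimen2 => /andP[].
  (* Dilating by the inverse [u] of [q] moves frequency [q] to 1. *)
  rewrite -(ft_mul m0 fm qo cum) -(periodic_modn (ft_periodic m0 _)) uq sqn_ft1.
  apply: (@second_largest_modulus R m (fun k => f (u * k)%N)) => //.
    exact: antiperiodic_mul.
  by move=> [t ht]; apply: nex; exists u => //; exists t.
apply: le_trans (mermin_value_ge R m0 p.+1 m_gt1).
have mR0 : m%:R != 0 :> R by rewrite pnatr_eq0 -lt0n.
have -> : 2 * ((s ^+ 2)^-1) ^+ p.+1 = m%:R ^+ 2 * ((s ^+ 2)^-1) ^+ p * (2 / (m%:R * s) ^+ 2).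
  by rewrite exprS; move: (_ ^+ p) => e; field; rewrite mR0 lt0r_neq0.
(* One factor [|F|^2] is kept for Parseval; the other [p] are bounded by [mu2]. *)
apply: (@le_trans _ _ (\sum_(l < m) sqn (ft m f l.*2.+1) * mu2 ^+ p)).
  rewrite /powsum; apply: ler_sum => l _; rewrite exprS ler_wpM2l ?sqn_ge0 //.
  by apply: lerXn2r; rewrite ?nnegrE ?sqn_ge0 // small.
rewrite -mulr_suml (parseval m0) (eq_bigr (fun=> 1)) => [|k _]; last first.
  by case: (f1 k) => ->; rewrite ?sqrrN expr1n.
rewrite sumr_const card_ord -expr2 -mulrA ler_wpM2l ?sqr_ge0 //.
have -> : mu2 ^+ p = ((s ^+ 2)^-1) ^+ p * (1 - 4 * s ^+ 2) ^+ p.*2.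
  by rewrite /mu2 expr_div_n exprMn -exprM mul2n [LHS]mulrC.
by rewrite ler_wpM2l // exprn_ge0 // invr_ge0 sqr_ge0.
Qed.

End PowsumBound.

(** * The threshold on the number of parties *)

Section Threshold.
Variable R : realType.
Local Notation theta m := (@pi R / (2 * m%:R)).
Local Notation s m := (sin (theta m)).

Lemma sqr_sin_pi4 : sin (@pi R / 4) ^+ 2 = 1 / 2.
Proof.
have := cos_mulr2n (@pi R / 4); rewrite cos2sin2.
have -> : pi / 4 *+ 2 = pi / 2 :> R by rewrite -mulr_natr; field.
by rewrite cos_pihalf -mulr_natr; lra.
Qed.

(** Equality holds at [m = 2], and doubling [m] cannot decrease [m sin (pi / 2m)], since
    [sin 2t = 2 sin t cos t]. This makes the numerator in [n_even] nonpositive. *)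
Lemma pow2_mul_sin_ge k : 2 <= ((2 ^ k.+1)%:R * s (2 ^ k.+1)%N) ^+ 2.
Proof.
elim: k => [|k IH].
  rewrite expn1; have -> : pi / (2 * 2%:R) = pi / 4 :> R by rewrite -natrM.
  by rewrite exprMn sqr_sin_pi4; lra.
apply: (le_trans IH); rewrite [in leRHS]expnS natrM; set m := (2 ^ k.+1)%:R.
have m0 : m != 0 by rewrite pnatr_eq0 expn_eq0.
have -> : pi / (2 * m) = (pi / (2 * (2 * m))) *+ 2 by rewrite -mulr_natr; field.
set t := pi / _; rewrite sin_mulr2n -mulr_natr.
have -> : (m * (cos t * sin t * 2)) ^+ 2 = (2 * m * sin t) ^+ 2 * cos t ^+ 2 by ring.
by rewrite ler_piMr ?sqr_ge0 // -(cos2Dsin2 t) lerDl sqr_ge0.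
Qed.

(** [1 - 2 * s^2] is the cosine of an angle at most [pi / 4], hence exceeds 1/2. *)
Lemma four_sqr_sin_lt1 m : (4 <= m)%N -> 4 * s m ^+ 2 < 1.
Proof.
move=> m4; have mR : 4 <= m%:R :> R by rewrite (ler_nat R 4).
have m0 : m%:R != 0 :> R by rewrite pnatr_eq0; lia.
have := cos_mulr2n (theta m); rewrite cos2sin2.
have -> : cos (theta m *+ 2) = sin (pi / 2 - theta m *+ 2).
  by rewrite sinB sin_pihalf cos_pihalf; ring.
have pi0 := pi_gt0 R.
have tm : theta m *+ 2 <= pi / 4.
  have -> : theta m *+ 2 = pi / m%:R by rewrite -mulr_natr; field.
  by rewrite ler_pM2l // lef_pV2 ?posrE //; lra.
have t0 : 0 <= theta m by rewrite divr_ge0 ?(ltW pi0) //; lra.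
have h1 : sin (pi / 4) <= sin (pi / 2 - theta m *+ 2).
  by apply: sin_ge_pi; [lra|rewrite -mulr_natr in tm *; lra].
have h2 : 0 < sin (@pi R / 4) by apply: sin_gt0_pi; lra.
have := sqr_sin_pi4; move: h1 h2; rewrite [(1 - _) *+ 2]mulr2n.
by move: (sin (@pi R / 4)) (sin (pi / 2 - _)) (s m) => u v w *; nra.
Qed.

Lemma threshold m x p : m = (2 ^ x)%N -> (2 <= m)%N -> n_even R m <= p.*2%:Z ->
  (0 < p)%N /\ ((4 <= m)%N ->
    (1 - 4 * s m ^+ 2) ^+ p.-1.*2 <= 2 / (m%:R * s m) ^+ 2).
Proof.
move=> mx m2; rewrite /n_even ceil_le_int -pmulrn.
have x0 : x = x.-1.+1 by case: x mx m2 => [->|].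
have ms2 : 2 <= (m%:R * s m) ^+ 2 by rewrite mx x0; exact: pow2_mul_sin_ge.
have sp : 0 < s m := sin_theta_gt0 R m2.
have m0 : 0 < m%:R :> R by rewrite ltr0n; lia.
have ms0 : 0 < m%:R * s m by rewrite mulr_gt0.
have [m4|] := leqP 4 m; last first.
  (* Here [m = 2]: the logarithm of -1 is 0 by convention, so the threshold is 2 and gives only
     [0 < p]. *)
  rewrite mx x0; case: x.-1 => [|k]; last by rewrite !expnS; lia.
  move=> _; rewrite expn1.
  have -> : pi / (2 * 2%:R) = pi / 4 :> R by rewrite -natrM.
  rewrite sqr_sin_pi4 [ln (1 - _)]ln0; last by lra.
  rewrite invr0 mulr0 addr0 mulr1 (ler_nat R 2) => p2.
  by split=> //; lia.
have := four_sqr_sin_lt1 m4; set c := 1 - _ => c1.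
have c0 : 0 < c < 1.
  rewrite /c; have := exprn_gt0 2 sp; move: c1; move: (_ ^+ 2) => w *.
  by apply/andP; split; lra.
have L0 := ln_lt0 c0; set A := ln (Num.sqrt 2) - _.
have A2 : A *+ 2 = ln (2 / (m%:R * s m) ^+ 2).
  have l2 : ln 2 = ln (Num.sqrt 2) *+ 2 :> R by rewrite -lnXn ?sqrtr_gt0 // sqr_sqrtr.
  by rewrite ln_div ?posrE ?exprn_gt0 // l2 lnXn // -mulrnBl.
have q0 : 0 < 2 / (m%:R * s m) ^+ 2 by rewrite divr_gt0 // exprn_gt0.
have A0 : A <= 0.
  have : A *+ 2 <= 0 by rewrite A2 ln_le0 // ler_pdivrMr ?exprn_gt0 // mul1r.
  by rewrite pmulrn_lle0.
have r0 : 0 <= A / ln c by rewrite ler_ndivlMr // mul0r.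
have rE : A / ln c * ln c = A by rewrite divfK // ltr0_neq0.
move: r0 rE; set r := A / _ => r0 rE hp; clearbody r A.
have p0 : (0 < p)%N.
  rewrite -double_gt0 -(ltr_nat R); lra.
split=> // _; rewrite -ler_ln ?posrE ?exprn_gt0 //; last by case/andP: c0.
rewrite -A2 lnXn; last by case/andP: c0.
have e : p.*2%:R = p.-1.*2%:R + 2 :> R by rewrite -natrD addn2 -doubleS prednK.
have hq : r * 2 <= p.-1.*2%:R by lra.
(* The goal now compares logarithms; multiplying [hq] by the negative [ln c] reverses it. *)
rewrite -[A *+ 2]mulr_natr -[ln c *+ _]mulr_natr -rE.
by have := ler_wnM2r (ltW L0) hq; rewrite mulrAC [ln c * _]mulrC.
Qed.

End Threshold.

(** * From strategies to power sums *)

Section Strategies.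
Variables (R : realType) (m : nat).
Local Open Scope complex_scope.
Local Notation Re := complex.Re.

Definition extend (b : {ffun 'I_m.+1 -> bool}) (k : nat) : R :=
  (-1) ^+ (k %/ m.+1) * (-1) ^+ b (inord (k %% m.+1)).

Lemma extend_antiperiodic b : antiperiodic m.+1 (extend b).
Proof.
by move=> k; rewrite /extend modnDr divnDr // divnn addn1 exprS mulN1r mulNr.
Qed.

Lemma extend_pm1 b k : extend b k = 1 \/ extend b k = -1.
Proof.
rewrite /extend -signr_odd -signr_addb.
by case: (_ (+) _); [right|left]; rewrite ?expr1 ?expr0.
Qed.

Lemma extend_ord b (k : 'I_m.+1) : extend b k = (-1) ^+ b k.
Proof. by rewrite /extend divn_small // mul1r modn_small // inord_val. Qed.

Lemma mermin_ft n (a : strategies m.+1 n.+1) :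
  mermin R a = (m.+1%:R ^+ n.+1)^-1 *
    \sum_(l < m.+1) Re (\prod_(j < n.+1) ft m.+1 (extend (a j)) l.*2.+1).
Proof.
rewrite /mermin -Re_sum (sum_prod_ft (ltn0Sn m)) /= exprSr invfM -mulrA; congr (_ * _).
rewrite mulKf ?pnatr_eq0 //; apply: eq_bigr => x _; congr (_ * _).
by apply: eq_bigr => j _; rewrite extend_ord.
Qed.

Lemma sqn_prod (I : Type) (r : seq I) (P : pred I) (F : I -> R[i]) :
  sqn (\prod_(i <- r | P i) F i) = \prod_(i <- r | P i) sqn (F i).
Proof.
by apply: big_morph => [z1 z2|]; [exact: sqnM | rewrite /sqn /= expr1n expr0n addr0].
Qed.

Lemma Re_le_sqrt_sqn (z : R[i]) : Re z <= Num.sqrt (sqn z).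
Proof.
apply: (le_trans (ler_norm _)); rewrite -sqrtr_sqr ler_wsqrtr //.
by rewrite /sqn lerDl sqr_ge0.
Qed.

(** AM-GM applied to the powers [E i ^+ n.+1]. *)
Lemma prod_le_mean_pow n (E : 'I_n.+1 -> R) : (forall i, 0 <= E i) ->
  \prod_i E i <= (\sum_i E i ^+ n.+1) / n.+1%:R.
Proof.
move=> E0; have En i : 0 <= E i ^+ n.+1 by rewrite exprn_ge0.
have [+ _] := leif_AGM (A := 'I_n.+1) (E := fun i => E i ^+ n.+1) (fun i _ => En i).
rewrite card_ord prodrXl ler_pXn2r // nnegrE; first by rewrite prodr_ge0.
by rewrite divr_ge0 // sumr_ge0.
Qed.

Lemma Re_prod_le n p (F : 'I_n.+1 -> R[i]) : n.+1 = p.*2 ->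
  Re (\prod_j F j) <= (\sum_j sqn (F j) ^+ p) / n.+1%:R.
Proof.
move=> np; apply: (le_trans (Re_le_sqrt_sqn _)); rewrite sqn_prod.
have -> : Num.sqrt (\prod_j sqn (F j)) = \prod_j Num.sqrt (sqn (F j)).
  elim/big_rec2: _ => [|i y1 y2 _ <-]; first by rewrite sqrtr1.
  by rewrite sqrtrM ?sqn_ge0.
have h0 j : 0 <= Num.sqrt (sqn (F j)) by exact: sqrtr_ge0.
apply: (le_trans (prod_le_mean_pow h0)).
rewrite le_eqVlt; apply/orP; left; apply/eqP; congr (_ / _); apply: eq_bigr => j _.
by rewrite np -mul2n exprM sqr_sqrtr ?sqn_ge0.
Qed.

(** After AM-GM at each frequency, exchanging the sums leaves the average of the parties' power
    sums. *)
Lemma mermin_le n p T (a : strategies m.+1 n.+1) : n.+1 = p.*2 ->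
  (forall j, powsum m.+1 p (extend (a j)) <= T) ->
  mermin R a <= (m.+1%:R ^+ n.+1)^-1 * T.
Proof.
move=> np aT; rewrite mermin_ft ler_wpM2l ?invr_ge0 ?exprn_ge0 //.
apply: (@le_trans _ _ (\sum_(l < m.+1)
    (\sum_j sqn (ft m.+1 (extend (a j)) l.*2.+1) ^+ p) / n.+1%:R)).
  by apply: ler_sum => l _; exact: Re_prod_le.
rewrite -mulr_suml exchange_big ler_pdivrMr ?ltr0n //=.
apply: (@le_trans _ _ (\sum_(j < n.+1) T)); first by apply: ler_sum => j _; exact: aT.
by rewrite sumr_const card_ord mulr_natr.
Qed.

(* The odd parties play [k |-> extend a (- k)], so that their transform is the
   complex conjugate of that of the even parties and the products are positive. *)
Definition alternating_strategies n : strategies m.+1 n :=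
  [ffun j : 'I_n => [ffun k : 'I_m.+1 => odd j && (k != 0%N :> nat)]].

Lemma prod_alternating p (A B : R[i]) :
  \prod_(j < p.*2) (if odd j then A else B) = (B * A) ^+ p.
Proof.
elim: p => [|p IH]; first by rewrite big_ord0.
by rewrite doubleS !big_ord_recr /= IH odd_double /= exprSr mulrA.
Qed.

Lemma mermin_alternating n p : n.+1 = p.*2 ->
  mermin R (alternating_strategies n.+1) = (m.+1%:R ^+ n.+1)^-1 * mermin_value R m.+1 p.
Proof.
move=> np; rewrite mermin_ft; congr (_ * _); apply: eq_bigr => l _.
pose F := ft m.+1 (fun _ => 1 : R) l.*2.+1.
(* An odd party plays 1 at setting 0 and -1 elsewhere, so its transform is [1 - (F - 1)]. *)
have fE (j : 'I_n.+1) : ft m.+1 (extend (alternating_strategies n.+1 j)) l.*2.+1 =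
    if odd j then 2 - F else F.
  case: ifP => jo; rewrite /F /ft; last first.
    by apply: eq_bigr => k _; rewrite extend_ord !ffunE jo.
  rewrite !big_ord_recl !extend_ord !ffunE jo /= muln0 !expr0 mulr1.
  have -> : 2 - (1%:C + \sum_(i < m) 1%:C * zeta R m.+1 ^+ (l.*2.+1 * bump 0 i)) =
      1%:C - \sum_(i < m) 1%:C * zeta R m.+1 ^+ (l.*2.+1 * bump 0 i) by rewrite rmorph1; ring.
  rewrite -sumrN; congr (_ + _); apply: eq_bigr => k _.
  have := extend_ord (alternating_strategies n.+1 j) (lift ord0 k).
  by rewrite !ffunE jo /= expr1 => ->; rewrite rmorphN mulNr.
under eq_bigr => j _ do rewrite fE.
rewrite np prod_alternating (ft_ones_reflection (ltn0Sn m)) //; last by rewrite /= odd_double.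
by rewrite -rmorphXn.
Qed.

End Strategies.

(** * Folding the sum and computing the local bound *)

Lemma mermin_value_half (R : realType) (h p : nat) :
  mermin_value R h.*2 p =
  2 * \sum_(0 <= j < h) 1 / sin ((2 * j + 1)%:R * pi / (2 * h.*2%:R)) ^+ p.*2.
Proof.
pose g j : R := 1 / sin ((2 * j + 1)%:R * pi / (2 * h.*2%:R)) ^+ p.*2.
have -> : mermin_value R h.*2 p = \sum_(0 <= j < h.*2) g j.
  rewrite big_mkord; apply: eq_bigr => l _; rewrite /g div1r exprVn -exprM mul2n.
  by rewrite [(2 * l)%N]mul2n addn1 mulrA.
(* The second half, read backwards, repeats the first because [sin (pi - t) = sin t]. *)
rewrite mulr_natl mulr2n (big_cat_nat _ (n := h)) //=; last by rewrite -addnn leq_addr.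
congr (_ + _); rewrite -addnn -{1}[h]add0n big_addn addnK big_nat_rev add0n.
rewrite !big_nat; apply: eq_bigr => j /andP[_ jh]; rewrite /g; congr (1 / _ ^+ _).
have h0 : h.*2%:R != 0 :> R by rewrite pnatr_eq0; lia.
have -> : (2 * (h - j.+1 + h) + 1)%:R * pi / (2 * h.*2%:R) =
    pi - (2 * j + 1)%:R * pi / (2 * h.*2%:R) :> R.
  have -> : (2 * (h - j.+1 + h) + 1)%:R = 2 * h.*2%:R - (2 * j + 1)%:R :> R.
    by rewrite -natrM -natrB; [congr _%:R|]; lia.
  by field.
by rewrite sinB sinpi cospi addnn; ring.
Qed.

Theorem proposition1 (R : realType) (m x n : nat)
    (hm : m = (2 ^ x)%N) (hm2 : (2 <= m)%N)
    (hn : ~~ odd n) (hn_even : n_even R m <= n%:Z) :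
  local_bound R m n =
    2 / m%:R ^+ n *
    \sum_(0 <= j < m./2) 1 / sin ((2 * j + 1)%:R * pi / (2 * m%:R)) ^+ n.
Proof.
have np : n = n./2.*2 by rewrite even_halfK.
move: hn_even; rewrite np => /(threshold hm hm2); rewrite -np => -[p0 hp].
have m2 : m = m./2.*2.
  by case: x hm => [|y] e; [move: hm2; rewrite e | rewrite e expnS mul2n doubleK].
have -> : 2 / m%:R ^+ n * \sum_(0 <= j < m./2) 1 / sin ((2 * j + 1)%:R * pi / (2 * m%:R)) ^+ n
    = (m%:R ^+ n)^-1 * mermin_value R m n./2.
  have := mermin_value_half R m./2 n./2; rewrite -m2 -np => ->.
  by rewrite mulrCA mulrA.
have psle f : antiperiodic m f -> (forall k, f k = 1 \/ f k = -1) ->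
    powsum m n./2 f <= mermin_value R m n./2.
  move=> fm f1; have [m4|] := leqP 4 m.
    rewrite -(prednK p0); apply: (powsum_le hm hm2) => //; last exact: hp.
    exact/ltW/four_sqr_sin_lt1.
  move=> m4; have e2 : m = 2%N by lia.
  (* For [m = 2] each of the four sign patterns is a half-circle, so equality holds without the
     threshold estimate. *)
  rewrite (powsum_consecutive (ltnW hm2)) //.
  move: fm; rewrite e2 => fm.
  have f2 : f 2%N = - f 0%N := fm 0%N.
  have f3 : f 3%N = - f 1%N := fm 1%N.
  have f4 : f 4%N = f 0%N by rewrite (fm 2%N) f2 opprK.
  case: (f1 0%N) => f0; case: (f1 1%N) => f1'.
  - by exists 0%N => -[|[|]].
  - by exists 3%N => -[|[|]] //= _; rewrite ?f3 ?f4 ?f1' ?opprK.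
  - by exists 1%N => -[|[|]] //= _; rewrite ?f2 ?f0 ?opprK.
  - by exists 2%N => -[|[|]] //= _; rewrite ?f2 ?f3 ?f0 ?f1' ?opprK.
have n0 : (0 < n)%N by rewrite np double_gt0.
clear hm hp m2; case: m hm2 psle => // m _ psle.
case: n n0 np psle {hn p0} => // n _ np psle.
have ub (a : strategies m.+1 n.+1) :
    mermin R a <= (m.+1%:R ^+ n.+1)^-1 * mermin_value R m.+1 n.+1./2.
  by apply: (mermin_le np) => j; apply: psle; [exact: extend_antiperiodic|exact: extend_pm1].
apply/le_anti/andP; split; first by apply: bigmax_le => [|a _]; exact: ub.
by rewrite -(mermin_alternating _ _ np); exact: le_bigmax.
Qed.
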